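(* Let $G=(V,E)$ be a finite graph with $V\neq\emptyset$ and let $\mathbf{k}$ be a field. For each ordered partition $\pi$ of $V$, let $\mathbf{P}_\pi\subset\mathbb{R}^V$ be the polytope associated with the $\pi$-residue space of $G$, and let $\mathbf{P}_{\mathrm{res}}=\mathbf{P}_{\pi_0}$ be the residue polytope of $G$, where $\pi_0=(V)$ is the trivial ordered partition. Then: (i) for each ordered partition $\pi$ of $V$, the polytope $\mathbf{P}_\pi$ is a face of $\mathbf{P}_{\mathrm{res}}$; (ii) each (nonempty) face of $\mathbf{P}_{\mathrm{res}}$ equals $\mathbf{P}_\pi$ for some ordered partition $\pi$ of $V$; (iii) if $\pi,\pi'$ are ordered partitions of $V$ such that $\pi'$ is a coarsening of $\pi$, then $\mathbf{P}_{\pi'}\supseteq\mathbf{P}_\pi$, and so $\mathbf{P}_\pi$ is a face of $\mathbf{P}_{\pi'}$.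
   Context: Graphs are finite; loops and multiple edges are allowed. $\mathbb{E}$ denotes the set of arrows of $G$: each edge $e=\{v,w\}$ gives two arrows $v\to w$ and $w\to v$ (a loop also gives two distinct arrows, corresponding to its two half-edges). If $a$ is an arrow $v\to w$, its tail is $v$, its head is $w$, and $\bar a$ denotes the reverse arrow on the same edge. For $v\in V$, $\mathbb{E}_v$ is the set of arrows with tail $v$. An ordered partition $\pi=(\pi_1,\dots,\pi_r)$ of $V$ is a partition of $V$ into nonempty parts together with a total order on the parts; its level function is $h:V\to[r]=\{1,\dots,r\}$, with $h(v)=n$ iff $v\in\pi_n$. An edge $\{u,v\}$ is vertical if $h(u)\ne h(v)$ and horizontal otherwise; an arrow is vertical or horizontal according to its edge. A vertical arrow $u\to v$ is upward if $h(u)>h(v)$ and downward if $h(u)<h(v)$. The $\pi$-residue space $\mathcal{G}_\pi$ is the subspace of all $\psi=(\psi_a)_{a\in\mathbb{E}}\in\mathbf{k}^{\mathbb{E}}$ satisfying: (R1) $\psi_a=0$ for every downward arrow $a$. (R2) $\sum_{a\in\mathbb{E}_v}\psi_a=0$ for every $v\in V$. (R3) $\psi_a+\psi_{\bar a}=0$ for every horizontal arrow $a$. (R4) For each $n\in[r]$ and each connected component $\Xi$ of the induced subgraph $G[\{v\in V: h(v)<n\}]$, $\sum_{a}\psi_a=0$, where the sum runs over all upward arrows $a$ with tail of level $n$ and head in $\Xi$. For $I\subseteq V$, let $\theta_I:\mathbf{k}^{\mathbb{E}}=\bigoplus_{v\in V}\mathbf{k}^{\mathbb{E}_v}\to\bigoplus_{v\in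 I}\mathbf{k}^{\mathbb{E}_v}$ be the projection, and put $\gamma_\pi(I)=\dim_{\mathbf{k}}\theta_I(\mathcal{G}_\pi)$. For $q\in\mathbb{R}^V$ write $q(I)=\sum_{v\in I}q(v)$. Define $$\mathbf{P}_\pi=\{q\in\mathbb{R}^V : q(I)\le\gamma_\pi(I)\text{ for all }I\subseteq V,\text{ with equality for } I=V\}.$$ For ordered partitions $\pi=(\pi_1,\dots,\pi_r)$ and $\pi'=(\pi'_1,\dots,\pi'_s)$ with level functions $h:V\to[r]$ and $h':V\to[s]$, $\pi'$ is a coarsening of $\pi$ (written $\pi'\succeq\pi$) if $h'=c\circ h$ for some map $c:[r]\to[s]$ with $c(n_1)\le c(n_2)$ whenever $n_1\le n_2$. *)

(* Defs.v *)
From HB Require Import structures.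
From mathcomp Require Import classical_sets reals.
From mathcomp Require Import all_boot all_order all_algebra.

Set Implicit Arguments.
Unset Strict Implicit.
Unset Printing Implicit Defensive.

Import Order.TTheory GRing.Theory Num.Theory.

Local Open Scope ring_scope.

(* The order of the two ends of an edge carries no meaning; it only serves to
   name the two arrows (half-edges) [(e, false)] and [(e, true)] on [e], which
   are distinct also when [e] is a loop. *)
Record mgraph := MGraph {
  vertex : finType;
  edge : finType;
  ends : edge -> vertex * vertex
}.

Definition arrow (G : mgraph) : finType := (edge G * bool)%type.

Section Arrows.
Variable G : mgraph.

Definition tail (a : arrow G) : vertex G :=
  if a.2 then (ends a.1).2 else (ends a.1).1.

Definition head (a : arrow G) : vertex G :=
  if a.2 then (ends a.1).1 else (ends a.1).2.

Definition rev_arrow (a : arrow G) : arrow G := (a.1, ~~ a.2).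

Definition adj_in (S : {set vertex G}) : rel (vertex G) := fun u v =>
  [&& u \in S, v \in S & [exists a, (tail a == u) && (head a == v)]].

Definition components (S : {set vertex G}) : {set {set vertex G}} :=
  equivalence_partition (connect (adj_in S)) S.

Lemma rev_arrowK : involutive rev_arrow.
Proof. by case=> e b; rewrite /rev_arrow /= negbK. Qed.

Lemma tail_rev a : tail (rev_arrow a) = head a.
Proof. by case: a => e []. Qed.

Lemma head_rev a : head (rev_arrow a) = tail a.
Proof. by case: a => e []. Qed.

Lemma adj_in_sym S : symmetric (adj_in S).
Proof.
move=> u v; rewrite /adj_in andbCA; congr [&& _, _ & _].
apply/existsP/existsP=> -[a /andP[Ha Hb]]; exists (rev_arrow a);
  by rewrite tail_rev head_rev Ha Hb.
Qed.

Lemma components_partition S : partition (components S) S.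
Proof.
apply: equivalence_partitionP => u v w _ _ _; split; first exact: connect0.
by move=> uv; apply: (same_connect (sym_connect_sym (adj_in_sym S)) uv).
Qed.

End Arrows.

Record ordered_partition (V : finType) := OrderedPartition {
  parts :> seq {set V};
  partsP : uniq parts && partition [set B in parts] [set: V]
}.

Section OrderedPartitions.
Variable V : finType.
Implicit Types pi : ordered_partition V.

Lemma level_subproof pi v :
  (find (fun B : {set V} => v \in B) pi < size pi)%N.
Proof.
rewrite -has_find; have /andP[_ /and3P[/eqP covV _ _]] := partsP pi.
have: v \in cover [set B in parts pi] by rewrite covV inE.
by case/bigcupP=> B; rewrite inE => piB Bv; apply/hasP; exists B.
Qed.

(* Levels are numbered from 0: the index set [r] is ['I_r], r = size pi. *)
Definition level pi (v : V) : 'I_(size pi) := Ordinal (level_subproof pi v).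

Lemma levelP pi (v : V) (n : 'I_(size pi)) :
  (v \in nth set0 pi n) = (level pi v == n).
Proof.
have /andP[Upi /and3P[_ /trivIsetP tI _]] := partsP pi.
have lv: v \in nth set0 pi (level pi v).
  by apply: (@nth_find _ set0 (fun B : {set V} => v \in B));
    rewrite has_find level_subproof.
apply/idP/eqP=> [nv | <- //]; apply/eqP; apply: contraTT nv => neq.
have := tI (nth set0 pi (level pi v)) (nth set0 pi n).
rewrite !inE !mem_nth ?nth_uniq // => /(_ isT isT neq) dis.
by rewrite (disjointFr dis lv).
Qed.

Lemma trivial_subproof : (0 < #|V|)%N ->
  uniq [:: [set: V]] && partition [set B in [:: [set: V]]] [set: V].
Proof.
move=> V0; have -> : [set B in [:: [set: V]]] = [set [set: V]].
  by apply/setP=> B; rewrite !inE.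
rewrite /= /partition /cover big_set1 eqxx /=; apply/andP; split.
  by apply/trivIsetP=> A B; rewrite !inE => /eqP-> /eqP->; rewrite eqxx.
by rewrite inE eq_sym -card_gt0 cardsT.
Qed.

Definition trivial_partition (V0 : (0 < #|V|)%N) : ordered_partition V :=
  OrderedPartition (trivial_subproof V0).

Definition coarsening pi' pi : Prop :=
  exists c : 'I_(size pi) -> 'I_(size pi'),
    (forall n1 n2 : 'I_(size pi), (n1 <= n2)%N -> (c n1 <= c n2)%N) /\
    (forall v, level pi' v = c (level pi v)).

End OrderedPartitions.

Section ResidueSpace.
Variables (k : fieldType) (G : mgraph).

Notation arrow_space := {ffun arrow G -> k^o}.
Implicit Types (psi : arrow_space) (pi : ordered_partition (vertex G)).

Definition horizontal pi (a : arrow G) : bool :=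
  level pi (tail a) == level pi (head a).

Definition upward pi (a : arrow G) : bool :=
  (level pi (head a) < level pi (tail a))%N.

Definition downward pi (a : arrow G) : bool :=
  (level pi (tail a) < level pi (head a))%N.

Definition lower_vertices pi (n : 'I_(size pi)) : {set vertex G} :=
  [set v | (level pi v < n)%N].

Definition R1_space pi : {vspace arrow_space} :=
  (\bigcap_(a | downward pi a)
     lker (linfun (fun psi => (psi a : k^o)%R)))%VS.

Definition R2_space : {vspace arrow_space} :=
  (\bigcap_(v : vertex G)
     lker (linfun (fun psi => (\sum_(a | tail a == v) psi a : k^o)%R)))%VS.

Definition R3_space pi : {vspace arrow_space} :=
  (\bigcap_(a | horizontal pi a)
     lker (linfun (fun psi => (psi a + psi (rev_arrow a) : k^o)%R)))%VS.

Definition R4_space pi : {vspace arrow_space} :=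
  (\bigcap_(n : 'I_(size pi))
   \bigcap_(Xi in components (lower_vertices n))
     lker (linfun (fun psi =>
       (\sum_(a | [&& upward pi a, level pi (tail a) == n & head a \in Xi])
          psi a : k^o)%R)))%VS.

Definition residue_space pi : {vspace arrow_space} :=
  (R1_space pi :&: R2_space :&: R3_space pi :&: R4_space pi)%VS.

Let memv_lker_linfun (f : arrow_space -> k^o) psi :
  linear f -> (psi \in lker (linfun f)) = (f psi == 0).
Proof.
move=> f_lin; pose fM := GRing.isLinear.Build _ _ _ _ f f_lin.
pose fL : {linear arrow_space -> k^o} := HB.pack f fM.
by rewrite memv_ker -[linfun f]/(linfun fL) lfunE.
Qed.

Let memv_bigcapP (I : finType) (P : pred I) (U : I -> {vspace arrow_space})
    psi :
  reflect (forall i, P i -> psi \in U i) (psi \in \bigcap_(i | P i) U i)%VS.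
Proof. by rewrite memvE; apply: (iffP subv_bigcapP)=> H i /H; rewrite -memvE. Qed.

Let sum_linear (P : pred (arrow G)) :
  linear ((fun psi => \sum_(a | P a) psi a) : arrow_space -> k^o).
Proof.
move=> c x y; rewrite scaler_sumr -big_split /=.
by apply: eq_bigr => a _; rewrite !ffunE.
Qed.

(* [linfun f] is only meaningful for linear [f]; this lemma confirms that
   [residue_space] is cut out by the intended equations. *)
Lemma residue_spaceP pi psi :
  reflect
    [/\ forall a, downward pi a -> psi a = 0,
        forall v, \sum_(a | tail a == v) psi a = 0,
        forall a, horizontal pi a -> psi a + psi (rev_arrow a) = 0
      & forall (n : 'I_(size pi)) (Xi : {set vertex G}),
          Xi \in components (lower_vertices n) ->
          \sum_(a | [&& upward pi a, level pi (tail a) == n & head a \in Xi])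
             psi a = 0]
    (psi \in residue_space pi).
Proof.
have lin1 a : linear ((fun psi => psi a) : arrow_space -> k^o).
  by move=> c x y; rewrite !ffunE.
have lin3 a : linear ((fun psi => psi a + psi (rev_arrow a))
                        : arrow_space -> k^o).
  by move=> c x y; rewrite !ffunE scalerDr addrACA.
apply: (iffP idP).
  rewrite !memv_cap -!andbA.
  case/and4P=> /memv_bigcapP H1 /memv_bigcapP H2 /memv_bigcapP H3
    /memv_bigcapP H4.
  split=> [a /H1|v|a /H3|n Xi XiP]; rewrite ?memv_lker_linfun //.
  - by move/eqP.
  - by have /= := H2 v isT; rewrite memv_lker_linfun => [/eqP|]; last exact: sum_linear.
  - by move/eqP.
  - have /memv_bigcapP/(_ Xi XiP) := H4 n isT.
    by rewrite memv_lker_linfun => [/eqP|]; last exact: sum_linear.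
case=> H1 H2 H3 H4; rewrite !memv_cap -!andbA; apply/and4P; split.
- by apply/memv_bigcapP=> a /H1 Ha; rewrite memv_lker_linfun // Ha.
- apply/memv_bigcapP=> v _; rewrite memv_lker_linfun; last exact: sum_linear.
  by rewrite H2.
- by apply/memv_bigcapP=> a /H3 Ha; rewrite memv_lker_linfun // Ha.
- apply/memv_bigcapP=> n _; apply/memv_bigcapP=> Xi XiP.
  rewrite memv_lker_linfun; last exact: sum_linear.
  by rewrite H4.
Qed.

(* The direct sum of the k^{E_v}, v in I, is k^{arrows with tail in I}. *)
Definition theta (I : {set vertex G}) :
    arrow_space -> {ffun {a : arrow G | tail a \in I} -> k^o} :=
  fun psi => [ffun a => psi (val a)].

Fact theta_is_linear I : linear (theta I).
Proof. by move=> c x y; apply/ffunP=> a; rewrite !ffunE. Qed.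

HB.instance Definition _ I :=
  GRing.isLinear.Build _ _ _ _ (theta I) (theta_is_linear I).

Definition gamma pi (I : {set vertex G}) : nat :=
  \dim (linfun (theta I) @: residue_space pi)%VS.

End ResidueSpace.

Arguments residue_space k {G} pi.
Arguments gamma k {G} pi I.

Definition residue_polytope_of (k : fieldType) (R : realType) (G : mgraph)
    (pi : ordered_partition (vertex G)) : set {ffun vertex G -> R} :=
  [set q | (forall I : {set vertex G},
              \sum_(v in I) q v <= (gamma k pi I)%:R) /\
           \sum_v q v = (gamma k pi [set: vertex G])%:R]%classic.

Arguments residue_polytope_of k R {G} pi.

Definition residue_polytope (k : fieldType) (R : realType) (G : mgraph)
    (V0 : (0 < #|vertex G|)%N) : set {ffun vertex G -> R} :=
  residue_polytope_of k R (trivial_partition V0).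

Arguments residue_polytope k R {G} V0.

(* Faces are nonempty by convention: F is a face of P if it is the nonempty
   locus in P where an inequality l . q <= b valid on P is an equality.
   The choice l = 0, b = 0 makes a nonempty P a face of itself. *)
Definition is_face (V : finType) (R : realType)
    (P F : set {ffun V -> R}) : Prop :=
  (F !=set0)%classic /\
  exists (l : {ffun V -> R}) (b : R),
    (forall q, P q -> \sum_v l v * q v <= b) /\
    F = [set q | P q /\ \sum_v l v * q v = b]%classic.

(* Main.v *)
Require Import Defs.
From mathcomp Require Import classical_sets reals.
From mathcomp Require Import all_boot all_order all_algebra.
From mathcomp Require Import ring lra zify.
(* Restores the head of an arrow, which [seq.head] would otherwise shadow. *)
Import Defs.

Set Implicit Arguments.
Unset Strict Implicit.
Unset Printing Implicit Defensive.

Import Order.TTheory GRing.Theory Num.Theory.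

(** For the trivial ordered partition the residue space is the space of flows
    of the graph (antisymmetric, divergence-free functions on arrows).  Let [f]
    be its [gamma]; it is a rank function, hence submodular
    ([rank_submodular]), and the residue polytope is the base polytope of [f].
    Given levels [h : V -> nat], let [U n] be the set of vertices of level at
    least [n].

    Polyhedral half.  If a linear form [l] is a strictly increasing function of
    the level, Abel summation writes [l . q] as a constant multiple of [q(V)]
    plus a combination of the numbers [q(U n)] with positive coefficients
    ([level_form]).  On the base polytope [q(U n) <= f(U n)], and the greedy
    point attains all these bounds at once ([greedy_tight]).  So the locus where
    [l] is maximal is the locus of points tight on every [U n], and every
    nonempty face has this form for the levels given by the values of [l].
    The tight locus is again a base polytope ([base_polytope_minor]), that of
      I |-> sum over n of f(U (n+1) u (I n level n)) - f(U (n+1)).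

    Graph half.  This function is [gamma] of the ordered partition
    ([gamma_minor]).  Indeed the terms of the sum are the ranks, on the part of
    [I] in level [n], of the flows that vanish on arrows leaving [U (n+1)], i.e.
    of the flows on the subgraph of the levels up to [n].  Restricting such a
    flow to the arrows leaving level [n] gives an element of the residue space
    ([restrict_flow]): the condition on a component of the lower levels says
    that the component receives nothing in total.  Conversely, this condition
    is what is needed to route the incoming values through the component, so
    that every level-[n] part extends to a flow ([extend_flow]).

    Together: the polytope of an ordered partition is the tight locus of its
    upper level sets ([residue_polytope_tight]), which gives the first two
    claims.  Coarsening an ordered partition only removes some upper level
    sets, hence some tightness conditions, which gives the third. *)

(** * Base polytopes of submodular functions *)

Section BasePolytope.
Local Open Scope ring_scope.
Variables (V : finType) (R : realFieldType).
Implicit Types (I : {set V}) (q : {ffun V -> R}) (f : {set V} -> R).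

Definition base_polytope f q : Prop :=
  (forall I, \sum_(v in I) q v <= f I) /\ \sum_v q v = f [set: V].

Definition upset (h : V -> nat) n : {set V} := [set v | (n <= h v)%N].

Definition slice f (h : V -> nat) I n : R :=
  f (upset h n.+1 :|: (I :&: [set v | h v == n])) - f (upset h n.+1).

(** The rank function of the direct sum, over the levels [n], of the minor of
    [f] on level [n]: higher levels contracted, lower levels deleted. *)
Definition minor f (h : V -> nat) r I : R := \sum_(n < r) slice f h I n.

Definition tight f (h : V -> nat) q : Prop :=
  forall n, \sum_(v in upset h n) q v = f (upset h n).

Lemma base_polytope_setT f q : base_polytope f q ->
  \sum_(v in [set: V]) q v = f [set: V].
Proof. by case=> _ <-; apply: eq_bigl => v; rewrite inE. Qed.

Lemma upset0 h : upset h 0 = [set: V].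
Proof. by apply/setP=> v; rewrite !inE. Qed.

Lemma upset_large h r n : (forall v, (h v < r)%N) -> (r <= n)%N ->
  upset h n = set0.
Proof. by move=> hr rn; apply/setP=> v; rewrite !inE; have := hr v; lia. Qed.

Lemma upsetS h n : upset h n = upset h n.+1 :|: [set v | h v == n].
Proof. by apply/setP=> v; rewrite !inE; lia. Qed.

Lemma telescope_ord r (g : nat -> R) :
  \sum_(n < r) (g n - g n.+1) = g 0%N - g r.
Proof.
rewrite -(big_mkord xpredT (fun n => g n - g n.+1)).
rewrite (eq_bigr (fun n => - (g n.+1 - g n))); last by move=> i _; ring.
by rewrite sumrN telescope_sumr // opprB.
Qed.

Lemma sum_disjointU (A B : {set V}) q : [disjoint A & B] ->
  \sum_(v in A :|: B) q v = \sum_(v in A) q v + \sum_(v in B) q v.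
Proof.
move=> AB; by rewrite -bigU //; apply: eq_bigl => v; rewrite !inE.
Qed.

Lemma disjoint_upsetS h I n :
  [disjoint upset h n.+1 & I :&: [set v | h v == n]].
Proof.
rewrite -setI_eq0; apply/eqP/setP=> v; rewrite !inE.
by case: (v \in I) => //=; lia.
Qed.

Section Submodular.
Variables (f : {set V} -> R) (h : V -> nat) (r : nat).
Hypotheses (f0 : f set0 = 0)
  (fsub : forall A B, f (A :|: B) + f (A :&: B) <= f A + f B)
  (hr : forall v, (h v < r)%N).

(** Submodularity says that marginal gains decrease: adding the part of [I] in
    level [n] to all of [upset h n.+1] gains at most what adding it to
    [I :&: upset h n.+1] gains, and the latter gains telescope to [f I]. *)
Lemma minor_le I : minor f h r I <= f I.
Proof.
pose g n := f (I :&: upset h n).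
have -> : f I = \sum_(n < r) (g n - g n.+1).
  rewrite telescope_ord /g upset0 setIT (upset_large hr (leqnn r)).
  by rewrite setI0 f0 subr0.
apply: ler_sum => n _; rewrite /slice /g.
have := fsub (upset h n.+1) (I :&: upset h n).
have -> : upset h n.+1 :|: I :&: upset h n =
   upset h n.+1 :|: (I :&: [set v | h v == n]).
  by apply/setP=> v; rewrite !inE; case: (v \in I) => /=; lia.
have -> : upset h n.+1 :&: (I :&: upset h n) = I :&: upset h n.+1.
  by apply/setP=> v; rewrite !inE; case: (v \in I) => /=; lia.
by move=> ?; lra.
Qed.

(** The summands of level at least [m] telescope, the others vanish. *)
Lemma minor_upset m : minor f h r (upset h m) = f (upset h m).
Proof.
pose g n := f (upset h (maxn m n)).
have -> : f (upset h m) = g 0%N - g r.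
  by rewrite /g maxn0 [upset h (maxn m r)](upset_large hr) ?f0 ?subr0; last lia.
rewrite -telescope_ord; apply: eq_bigr => n _; rewrite /slice /g.
have [mn|nm] := leqP m n.
  rewrite (maxn_idPr (leqW mn)).
  congr (f _ - _); apply/setP=> v; rewrite !inE; lia.
rewrite (maxn_idPl nm).
suff -> : upset h m :&: [set v | h v == n] = set0 by rewrite setU0 !subrr.
by apply/setP=> v; rewrite !inE; lia.
Qed.

Lemma minor_setC_upset m :
  minor f h r (~: upset h m) = f [set: V] - f (upset h m).
Proof.
pose g n := f (upset h (minn m n)).
have -> : f [set: V] - f (upset h m) = g 0%N - g (maxn m r).
  by rewrite /g minn0 upset0; congr (_ - f (upset h _)); lia.
have -> : g (maxn m r) = g r.
  rewrite /g; have [mr|rm] := leqP m r.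
    by congr (f (upset h _)); lia.
  by congr f; rewrite !(upset_large hr) //; lia.
rewrite -telescope_ord; apply: eq_bigr => n _; rewrite /slice /g.
have [mn|nm] := leqP m n.
  rewrite (minn_idPl (leqW mn)).
  suff -> : ~: upset h m :&: [set v | h v == n] = set0
    by rewrite setU0 !subrr.
  by apply/setP=> v; rewrite !inE; lia.
rewrite (minn_idPr nm).
congr (f _ - _); apply/setP=> v; rewrite !inE; lia.
Qed.

(** From left to right, tightness on an upper set combines the bound on it with
    the bound on its complement, whose sum is the total.  From right to left,
    a tight [q] turns each summand of [minor] into a bound on the part of [I]
    in one level. *)
Lemma base_polytope_minor q :
  base_polytope (minor f h r) q <-> base_polytope f q /\ tight f h q.
Proof.
have minT : minor f h r [set: V] = f [set: V].
  by rewrite -(upset0 h) minor_upset.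
split=> [[qle qT]|[qP qt]].
  split; first by split=> [I|]; rewrite -?minT // (le_trans (qle I)) ?minor_le.
  move=> m; apply/eqP; rewrite eq_le -{1}minor_upset qle /=.
  have := qle (~: upset h m); rewrite minor_setC_upset.
  have := qT; rewrite (bigID (mem (upset h m))) /= minT.
  rewrite [X in _ -> X <= _ -> _](eq_bigl (fun v => v \notin upset h m)).
    by move=> ? ?; lra.
  by move=> v; rewrite inE.
split; last by rewrite minT; case: qP.
move=> I; rewrite (partition_big (fun v => Ordinal (hr v)) xpredT) //=.
apply: ler_sum => n _; rewrite /slice -qt.
have [/(_ (upset h n.+1 :|: (I :&: [set v | h v == n]))) le_q _] := qP.
move: le_q; rewrite sum_disjointU ?disjoint_upsetS //.
rewrite [X in _ + X <= _](_ : _ = \sum_(v in I | Ordinal (hr v) == n) q v).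
  by move=> ?; lra.
by apply: eq_bigl => v; rewrite !inE -val_eqE.
Qed.

End Submodular.

(** Refine the levels into a total order [h'].  Each level of [h'] is a single
    vertex, so [minor f h'] is additive, and the point whose coordinates are its
    values on singletons lies in its base polytope. *)
Lemma greedy_tight f (h : V -> nat) : f set0 = 0 ->
  (forall A B, f (A :|: B) + f (A :&: B) <= f A + f B) ->
  exists q, base_polytope f q /\ tight f h q.
Proof.
move=> f0 fsub; pose h' v := (h v * #|V| + enum_rank v)%N.
have rk (v : V) : (enum_rank v < #|V|)%N by exact: ltn_ord.
pose r := (\max_v h' v).+1.
have h'r v : (h' v < r)%N by rewrite ltnS; exact: (leq_bigmax v).
have h'inj : injective h'.
  move=> u v /(congr1 (modn^~ #|V|)); rewrite !modnMDl !modn_small //.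
  by move/val_inj/enum_rank_inj.
have up_h n : upset h n = upset h' (n * #|V|).
  apply/setP=> v; rewrite !inE /h'; have := rk v.
  have [nh _|hn rv] := leqP n (h v).
    by have := leq_mul nh (leqnn #|V|); lia.
  by have := leq_mul hn (leqnn #|V|); rewrite mulSn; lia.
pose q : {ffun V -> R} := [ffun v => slice f h' [set v] (h' v)].
have minE I : minor f h' r I = \sum_(v in I) q v.
  rewrite (partition_big (fun v => Ordinal (h'r v)) xpredT) //=.
  apply: eq_bigr => n _.
  have [/existsP[v /andP[vI /eqP vn]]|noI] :=
    boolP [exists v, (v \in I) && (h' v == n)].
    rewrite (big_pred1 v) => [|u].
      rewrite ffunE /slice vn; congr (f (_ :|: _) - _).
      apply/setP=> u; rewrite !inE -vn (inj_eq h'inj) andbb.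
      by case: eqP => [->|]; rewrite ?vI ?andbF.
    rewrite -val_eqE /= -vn (inj_eq h'inj).
    by case: eqP => [->|]; rewrite ?vI ?andbF.
  have emp v : (v \in I) && (h' v == n) = false.
    by apply: contraNF noI => P; apply/existsP; exists v.
  rewrite big1 /slice => [|v]; last by rewrite -val_eqE /= emp.
  suff -> : I :&: [set v | h' v == n] = set0 by rewrite setU0 subrr.
  by apply/setP=> v; rewrite !inE emp.
exists q; have /(base_polytope_minor f0 fsub h'r)[qP qt] :
    base_polytope (minor f h' r) q.
  by split=> [I|]; rewrite minE // ; apply: eq_bigl => v; rewrite inE.
by split=> // n; rewrite up_h.
Qed.

Section LinearForm.
Variables (h : V -> nat) (r : nat) (t : nat -> R).
Hypotheses (hr : forall v, (h v < r)%N)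
  (tinc : forall n, (n.+1 < r)%N -> t n < t n.+1).

(** For submodular [f] and increasing [t], the maximum on the base polytope of
    [f] of the form with coefficients [t (h v)]. *)
Definition level_max f : R :=
  t 0%N * f [set: V] + \sum_(n < r.-1) (t n.+1 - t n) * f (upset h n.+1).

(** Abel summation. *)
Lemma level_form q :
  \sum_v t (h v) * q v = level_max (fun I => \sum_(v in I) q v).
Proof.
rewrite /level_max mulr_sumr; under [X in _ + X]eq_bigr do rewrite mulr_sumr.
rewrite [X in _ + X](eq_bigr (fun n : 'I_r.-1 => \sum_v
  (if (n < h v)%N then (t n.+1 - t n) * q v else 0))); last first.
  by move=> n _; rewrite big_mkcond; apply: eq_bigr => v _; rewrite inE.
rewrite exchange_big /= [X in X + _](eq_bigl xpredT); last first.
  by move=> v; rewrite inE.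
rewrite -big_split /=; apply: eq_bigr => v _.
rewrite -big_mkcond -mulr_suml -mulrDl; congr (_ * _).
rewrite -(big_mkord (fun n => n < h v)%N (fun n => t n.+1 - t n)).
have hv : (h v <= r.-1)%N by have := hr v; lia.
rewrite (eq_bigl (fun n => true && (n < h v)%N)) //.
rewrite -(big_nat_widen 0 _ _ xpredT) //.
by rewrite telescope_sumr //; ring.
Qed.

Lemma level_form_le f q : base_polytope f q ->
  \sum_v t (h v) * q v <= level_max f.
Proof.
move=> qP; rewrite level_form /level_max (base_polytope_setT qP) lerD2l.
apply: ler_sum => n _; apply: ler_wpM2l; last by case: qP.
by rewrite subr_ge0 ltW // tinc //; have := ltn_ord n; lia.
Qed.

(** Equality in [level_form_le] forces equality in each summand, because the
    increments of [t] are positive. *)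
Lemma level_form_eq f q : f set0 = 0 -> base_polytope f q ->
  \sum_v t (h v) * q v = level_max f <-> tight f h q.
Proof.
move=> f0 qP; rewrite level_form /level_max (base_polytope_setT qP).
split=> [/addrI eqs|qt]; last first.
  by congr (_ + _); apply: eq_bigr => n _; rewrite qt.
have tgt (n : 'I_r.-1) : 0 < t n.+1 - t n.
  by rewrite subr_gt0 tinc //; have := ltn_ord n; lia.
pose gap (n : 'I_r.-1) := (t n.+1 - t n) *
   (f (upset h n.+1) - \sum_(v in upset h n.+1) q v).
have gap_ge0 n : xpredT n -> 0 <= gap n.
  by move=> _; apply: mulr_ge0; [exact: ltW | rewrite subr_ge0; case: qP].
have : \sum_n gap n = 0.
  rewrite /gap; under eq_bigr do rewrite mulrBr.
  by rewrite sumrB eqs subrr.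
move/(psumr_eq0P gap_ge0) => gap0 [|n].
  by rewrite upset0 (base_polytope_setT qP).
have [nr|rn] := ltnP n r.-1.
  have /eqP := gap0 (Ordinal nr) isT.
  by rewrite /gap mulf_eq0 (gt_eqF (tgt _)) orFb subr_eq0 => /eqP.
by rewrite (@upset_large h r) ?f0 ?big_set0 //; lia.
Qed.

End LinearForm.
End BasePolytope.

(** * Ranks of coordinate projections *)

Section Rank.
Local Open Scope ring_scope.
Variables (k : fieldType) (G : mgraph).
Notation arrow_space := {ffun arrow G -> k^o}.
Implicit Types (W : {vspace arrow_space}) (I A B J : {set vertex G}).

Definition vanishing I : {vspace arrow_space} := lker (linfun (theta I)).

Definition rank W I : nat := \dim (linfun (theta I) @: W)%VS.

Lemma vanishingP I (psi : arrow_space) :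
  reflect (forall a, tail a \in I -> psi a = 0) (psi \in vanishing I).
Proof.
rewrite memv_ker lfunE; apply: (iffP eqP) => [/ffunP eq0 a aI|eq0].
  by have := eq0 (Sub a aI); rewrite !ffunE.
by apply/ffunP=> a; rewrite !ffunE eq0 // (valP a).
Qed.

Lemma vanishingU A B : vanishing (A :|: B) = (vanishing A :&: vanishing B)%VS.
Proof.
apply/vspaceP=> psi; rewrite memv_cap.
apply/vanishingP/andP=> [eq0|[/vanishingP eqA /vanishingP eqB] a].
  by split; apply/vanishingP=> a aI; rewrite eq0 // inE aI ?orbT.
by rewrite inE => /orP[/eqA|/eqB].
Qed.

Lemma vanishingS A B : A \subset B -> (vanishing B <= vanishing A)%VS.
Proof.
move=> /subsetP sAB; apply/subvP=> psi /vanishingP eq0.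
by apply/vanishingP=> a /sAB; apply: eq0.
Qed.

Lemma rank_dim W I : (\dim (W :&: vanishing I) + rank W I)%N = \dim W.
Proof. exact: limg_ker_dim. Qed.

Lemma rank_setU W A J :
  rank W (A :|: J) = (rank W A + rank (W :&: vanishing A) J)%N.
Proof.
have := rank_dim W (A :|: J); have := rank_dim W A.
have := rank_dim (W :&: vanishing A)%VS J.
rewrite vanishingU capvA; lia.
Qed.

Lemma rank0 W : rank W set0 = 0%N.
Proof.
have /capv_idPl W0 : (W <= vanishing set0)%VS.
  by apply/subvP=> psi _; apply/vanishingP=> a; rewrite inE.
by have := rank_dim W set0; rewrite W0; lia.
Qed.

(** The spaces [N I] of vectors of [W] vanishing on [I] satisfy
    [N A :&: N B = N (A :|: B)] and [N A + N B <= N (A :&: B)]; dimensions of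
    sums and intersections do the rest. *)
Lemma rank_submodular W A B :
  (rank W (A :|: B) + rank W (A :&: B) <= rank W A + rank W B)%N.
Proof.
have := dimv_sum_cap (W :&: vanishing A) (W :&: vanishing B).
have -> : (W :&: vanishing A :&: (W :&: vanishing B))%VS =
          (W :&: vanishing (A :|: B))%VS.
  by apply/vspaceP=> psi; rewrite vanishingU !memv_cap; case: (psi \in W).
have : (W :&: vanishing A + W :&: vanishing B <= W :&: vanishing (A :&: B))%VS.
  by rewrite subv_add !capvS ?vanishingS ?subsetIl ?subsetIr.
move/dimvS; have := rank_dim W A; have := rank_dim W B.
have := rank_dim W (A :|: B); have := rank_dim W (A :&: B); lia.
Qed.

Lemma leq_rank W W' J :
    (forall psi, psi \in W -> exists2 phi, phi \in W' &
       forall a, tail a \in J -> phi a = psi a) ->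
  (rank W J <= rank W' J)%N.
Proof.
move=> lift; apply/dimvS/subvP=> _ /memv_imgP[psi /lift[phi phiW' eqJ] ->].
apply/memv_imgP; exists phi => //; rewrite !lfunE.
by apply/ffunP=> a; rewrite !ffunE eqJ // (valP a).
Qed.

End Rank.

(** * Flows with prescribed divergence *)

Section Flows.
Local Open Scope ring_scope.
Variables (k : fieldType) (G : mgraph).
Notation arrow_space := {ffun arrow G -> k^o}.
Implicit Types (psi phi chi : arrow_space) (S Xi : {set vertex G}).

Definition antisymmetric_flow psi : Prop :=
  forall a, psi a + psi (rev_arrow a) = 0.

Definition divergence psi (v : vertex G) : k := \sum_(a | tail a == v) psi a.

Lemma sum_rev (P : pred (arrow G)) (F : arrow G -> k) :
  \sum_(a | P a) F a = \sum_(a | P (rev_arrow a)) F (rev_arrow a).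
Proof. by rewrite (reindex_inj (inv_inj (@rev_arrowK G))). Qed.

(** The two arrows of each edge cancel; pairing them edge by edge is valid in
    characteristic 2 and for loops. *)
Lemma sum_antisymmetric psi (P : pred (arrow G)) :
  antisymmetric_flow psi -> (forall a, P (rev_arrow a) = P a) ->
  \sum_(a | P a) psi a = 0.
Proof.
move=> anti Prev; rewrite big_mkcond.
pose F e b := if P (e, b) then psi (e, b) else 0.
rewrite (eq_bigr (fun a : arrow G => F a.1 a.2)); last by case.
rewrite -(pair_bigA _ F) big1 // /F => e _.
rewrite big_bool /= -[P (e, true)]Prev /rev_arrow /=.
by case: ifP => _; rewrite ?addr0 // anti.
Qed.

(** One unit sent along a path inside [S]. *)
Lemma path_flow S u w : connect (adj_in S) u w ->
  exists chi, [/\ antisymmetric_flow chi,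
    forall a, ~~ ((tail a \in S) && (head a \in S)) -> chi a = 0 &
    forall v, divergence chi v = (v == u)%:R - (v == w)%:R].
Proof.
case/connectP=> p; elim: p u => [|x p IHp] u /=.
  move=> _ ->; exists 0; split=> [a|a _|v]; rewrite ?ffunE ?addr0 //.
  by rewrite subrr /divergence big1 // => a; rewrite ffunE.
case/andP=> /and3P[uS xS /existsP[a /andP[/eqP ta /eqP ha]]] px /(IHp _ px).
case=> chi [anti supp div].
exists [ffun b => (b == a)%:R - (b == rev_arrow a)%:R + chi b].
split=> [b|b|v].
- rewrite !ffunE (inv_eq (@rev_arrowK G)) (inj_eq (inv_inj (@rev_arrowK G))).
  by rewrite addrACA anti addr0 addrA subrK subrr.
- move=> bS; rewrite ffunE supp // addr0.
  have /negbTE-> : b != a by apply: contraNneq bS => ->; rewrite ta ha uS xS.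
  have /negbTE-> : b != rev_arrow a.
    by apply: contraNneq bS => ->; rewrite tail_rev head_rev ta ha uS xS.
  by rewrite subrr.
- rewrite /divergence; under eq_bigr do rewrite ffunE.
  rewrite big_split /= [X in _ + X]div sumrB.
  have sum_delta c : \sum_(b | tail b == v) (b == c)%:R = (v == tail c)%:R :> k.
    have [<-|neq] := eqVneq (tail c) v.
      by rewrite (bigD1 c) //= !eqxx big1 ?addr0 // => b /andP[_ /negbTE->].
    rewrite big1 // => b /eqP tb.
    by case: eqP => // bc; rewrite -bc tb eqxx in neq.
  by rewrite !sum_delta tail_rev ta ha addrA subrK.
Qed.

(** Send [d v] units from each [v] to the root of its component: the root then
    absorbs the total of [d] over the component, which is zero. *)
Lemma exists_flow S (d : vertex G -> k) :
    (forall Xi, Xi \in components S -> \sum_(v in Xi) d v = 0) ->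
  exists chi, [/\ antisymmetric_flow chi,
    forall a, ~~ ((tail a \in S) && (head a \in S)) -> chi a = 0 &
    forall v, v \in S -> divergence chi v = d v].
Proof.
move=> d0; have symS := sym_connect_sym (@adj_in_sym G S).
have [chi chiP] :=
  fin_all_exists (fun v => path_flow (connect_root (adj_in S) v)).
pose root := fingraph.root (adj_in S).
exists [ffun a => \sum_(v in S) d v * chi v a].
split=> [a|a aS|w wS].
- rewrite !ffunE -big_split big1 //= => v _.
  by case: (chiP v) => anti _ _; rewrite -mulrDr anti mulr0.
- rewrite ffunE big1 // => v _.
  by case: (chiP v) => _ supp _; rewrite supp ?mulr0.
rewrite /divergence; under eq_bigr do rewrite ffunE.
rewrite exchange_big /=.
rewrite (eq_bigr (fun v =>
  d v * (w == v)%:R - d v * (w == root v)%:R)); last first.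
  move=> v _; case: (chiP v) => _ _ divE.
  by rewrite -mulr_sumr -[X in _ * X]/(divergence (chi v) w) divE mulrBr.
rewrite sumrB (bigD1 w) //= eqxx mulr1 big1 ?addr0; last first.
  by move=> v /andP[_ /negbTE vw]; rewrite eq_sym vw mulr0.
rewrite (eq_bigr (fun v => if w == root v then d v else 0)); last first.
  by move=> v _; case: eqP; rewrite ?mulr1 ?mulr0.
rewrite -big_mkcondr /=.
have [/existsP[u /andP[uS /eqP wu]]|no_root] :=
  boolP [exists u, (u \in S) && (w == root u)]; last first.
  rewrite big_pred0 ?subr0 // => v; apply: contraNF no_root => P.
  by apply/existsP; exists v.
rewrite (eq_bigl (mem [set v in S | connect (adj_in S) u v])).
  by rewrite d0 ?subr0 //; apply/imsetP; exists u.
by move=> v; rewrite !inE wu /root root_connect.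
Qed.

End Flows.

(** * The residue space, one level at a time *)

Section ResidueLevels.
Local Open Scope ring_scope.
Variables (k : fieldType) (G : mgraph) (pi : ordered_partition (vertex G)).
Notation arrow_space := {ffun arrow G -> k^o}.
Implicit Types (psi phi chi : arrow_space) (S Xi : {set vertex G}).
Let h (v : vertex G) : nat := level pi v.

Let horizontalE a : horizontal pi a = (h (tail a) == h (head a)).
Proof. by []. Qed.

Let upwardE a : upward pi a = (h (head a) < h (tail a))%N.
Proof. by []. Qed.

Let level_eqE v (n : 'I_(size pi)) : (level pi v == n) = (h v == n).
Proof. by []. Qed.

Lemma component_closed S Xi u v (a : arrow G) : Xi \in components S ->
  u \in Xi -> v \in S -> tail a = u -> head a = v -> v \in Xi.
Proof.
case/imsetP=> x xS -> ; rewrite !inE => /andP[uS xu] vS ta ha; rewrite vS /=.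
apply: connect_trans xu (connect1 _); rewrite /adj_in uS vS /=.
by apply/existsP; exists a; rewrite ta ha !eqxx.
Qed.

Lemma component_sub S Xi v : Xi \in components S -> v \in Xi -> v \in S.
Proof. by case/imsetP=> x _ ->; rewrite inE => /andP[]. Qed.

Lemma lower_verticesE (n : 'I_(size pi)) v :
  (v \in lower_vertices n) = (h v < n)%N.
Proof. by rewrite inE. Qed.

(** Summing the conservation law over a component [Xi] of the lower levels, the
    arrows inside [Xi] cancel, and what remains is the flow between [Xi] and
    level [n]: arrows from [Xi] to other lower vertices do not exist, and the
    flow vanishes on those to higher levels. *)
Lemma restrict_flow psi (n : 'I_(size pi)) :
    antisymmetric_flow psi -> (forall v, divergence psi v = 0) ->
    psi \in vanishing k (upset h n.+1) ->
  [ffun a => if h (tail a) == n then psi a else 0] \in residue_space k pi.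
Proof.
move=> anti cons /vanishingP van.
have van_tail a : (n < h (tail a))%N -> psi a = 0.
  by move=> ?; apply: van; rewrite inE.
have van_head a : (n < h (head a))%N -> psi a = 0.
  move=> na; have := anti a; rewrite [psi (rev_arrow a)]van_tail ?tail_rev //.
  by rewrite addr0.
apply/residue_spaceP; split=> [a|v|a|m Xi XiP].
- rewrite /downward -/(h _) -/(h _) ffunE; case: eqP => // ->; exact: van_head.
- under eq_bigr do rewrite ffunE.
  have [hv|hv] := eqVneq (h v) n; last first.
    by rewrite big1 // => a /eqP->; rewrite (negbTE hv).
  rewrite -[RHS](cons v); apply: eq_bigr => a /eqP->; by rewrite hv eqxx.
- rewrite horizontalE !ffunE tail_rev => /eqP->.
  by case: ifP; rewrite ?anti ?addr0.
- have [mn|mn] := eqVneq m n; last first.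
    apply: big1 => a /and3P[_ /eqP lm _]; rewrite ffunE.
    by rewrite /h lm (inj_eq val_inj) (negbTE mn).
  subst m.
  have low v : v \in Xi -> (h v < n)%N.
    by move/(component_sub XiP); rewrite lower_verticesE.
  have : \sum_(a | tail a \in Xi) psi a = 0.
    rewrite (partition_big (@tail G) (mem Xi)) //= big1 // => v vXi.
    rewrite -[RHS](cons v); apply: eq_bigl => a.
    by case: eqP => [->|]; rewrite ?vXi ?andbF.
  rewrite (bigID (fun a => head a \in Xi)) /=.
  rewrite sum_antisymmetric //; last first.
    by move=> a; rewrite tail_rev head_rev andbC.
  rewrite add0r sum_rev (eq_bigr (fun a => - psi a)); last first.
    by move=> a _; apply/eqP; rewrite -addr_eq0 addrC anti.
  rewrite sumrN => /eqP; rewrite oppr_eq0 => /eqP out0; rewrite -[RHS]out0.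
  rewrite [LHS]big_mkcond [RHS]big_mkcond /=; apply: eq_bigr => a _.
  rewrite ffunE upwardE level_eqE tail_rev head_rev.
  have [hXi|hXi] := boolP (head a \in Xi); rewrite ?andbF //= andbT.
  have hn := low _ hXi.
  have [ta|ta] := eqVneq (h (tail a)) n.
    by rewrite ta hn; case: ifP => // /negbFE/low; rewrite ta ltnn.
  rewrite andbF; case: ifP => // tXi; apply/esym/van_tail.
  rewrite ltn_neqAle eq_sym ta leqNgt; apply: contra tXi => tn.
  apply: (component_closed (u := head a) (a := rev_arrow a) XiP) => //.
  - by rewrite lower_verticesE.
  - exact: tail_rev.
  - exact: head_rev.
Qed.

(** On arrows meeting level [n] antisymmetry prescribes the flow.  Strictly
    below level [n] it must drain the values [d] received from level [n], and the
    component condition on [phi] is the solvability condition of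
    [exists_flow]. *)
Lemma extend_flow phi (n : 'I_(size pi)) : phi \in residue_space k pi ->
  exists psi, [/\ antisymmetric_flow psi, forall v, divergence psi v = 0,
    psi \in vanishing k (upset h n.+1) &
    forall a, h (tail a) = n -> psi a = phi a].
Proof.
case/residue_spaceP=> R1 R2 R3 R4.
have R1' a : (h (tail a) < h (head a))%N -> phi a = 0 by exact: R1.
pose d v := \sum_(b | (h (tail b) == n) && (head b == v)) phi b.
have [|chi [anti supp div]] := @exists_flow k G (lower_vertices n) d.
  move=> Xi XiP; rewrite -[RHS](R4 n Xi XiP).
  rewrite [RHS](partition_big (@head G) (mem Xi)) /=; last by move=> a /and3P[].
  apply: eq_bigr => v vXi; apply: eq_bigl => a; rewrite upwardE level_eqE.
  have [ha|_] := eqVneq (head a) v; rewrite ?andbF // ha vXi !andbT.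
  have := component_sub XiP vXi; rewrite lower_verticesE => hv.
  by have [->|_] := eqVneq (h (tail a)) n; rewrite ?andbF // hv.
pose psi := [ffun a => if h (tail a) == n then phi a else
   if h (head a) == n then - phi (rev_arrow a) else chi a].
have psi_up a : (n < h (tail a))%N -> psi a = 0.
  move=> na; rewrite ffunE gtn_eqF //; case: eqP => [ha|_].
    by rewrite R1' ?oppr0 // tail_rev head_rev ha.
  by rewrite supp // !lower_verticesE ltnNge (ltnW na).
exists psi; split=> [a|v||a ta].
- rewrite !ffunE tail_rev head_rev rev_arrowK.
  have [ta|ta] := eqVneq (h (tail a)) n; have [ha|ha] := eqVneq (h (head a)) n.
  + by apply: R3; rewrite horizontalE ta ha.
  + by rewrite subrr.
  + by rewrite addNr.
  + exact: anti.
- rewrite /divergence; have [vn|nv|vn] := ltngtP (h v) n.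
  + rewrite (eq_bigr (fun a =>
      (if h (head a) == n then - phi (rev_arrow a) else 0) + chi a)).
      rewrite big_split /= [X in _ + X]div ?lower_verticesE // -big_mkcondr /=.
      rewrite sumrN /d [X in _ + X]sum_rev.
      apply/eqP; rewrite addrC subr_eq0; apply/eqP.
      by apply: eq_bigl => a; rewrite tail_rev head_rev andbC.
    move=> a /eqP ta; rewrite ffunE ta ltn_eqF //.
    case: eqP => [ha|]; rewrite ?add0r //.
    by rewrite supp ?addr0 // !lower_verticesE ha ltnn andbF.
  + by rewrite big1 // => a /eqP ta; rewrite psi_up ?ta.
  + rewrite -[RHS](R2 v); apply: eq_bigr => a /eqP ta.
    by rewrite ffunE ta vn eqxx.
- by apply/vanishingP=> a; rewrite inE; apply: psi_up.
- by rewrite ffunE ta eqxx.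
Qed.

Variable (V0 : (0 < #|vertex G|)%N).
Let flows := residue_space k (trivial_partition V0).

Lemma flowsP psi : reflect
  (antisymmetric_flow psi /\ forall v, divergence psi v = 0) (psi \in flows).
Proof.
have lev0 (u v : vertex G) :
    level (trivial_partition V0) u = level (trivial_partition V0) v.
  by apply: val_inj; rewrite /= !inE.
apply: (iffP (residue_spaceP _ _)) => [[_ R2 R3 _]|[anti cons]].
  by split=> // a; apply: R3; rewrite /horizontal (lev0 _ (head a)).
split=> // [a|n Xi _]; first by rewrite /downward (lev0 _ (head a)) ltnn.
by apply: big1 => a; rewrite /upward (lev0 _ (tail a)) ltnn.
Qed.

(** On level [n] the flows confined to the levels up to [n] and the residue
    space have the same restrictions.  In the residue space different levels are
    independent, so vanishing on higher levels does not constrain level [n]. *)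
Lemma rank_level (n : 'I_(size pi)) (I J : {set vertex G}) :
    (forall v, v \in J -> h v = n) ->
  rank (flows :&: vanishing k (upset h n.+1)) J =
  rank (residue_space k pi :&: vanishing k (I :&: upset h n.+1)) J.
Proof.
move=> Jn; apply/eqP; rewrite eqn_leq; apply/andP; split.
  apply: leq_rank => psi; rewrite memv_cap => /andP[/flowsP[anti cons] van].
  exists [ffun a => if h (tail a) == n then psi a else 0].
    rewrite memv_cap restrict_flow //=; apply/vanishingP=> a.
    by rewrite !inE ffunE => /andP[_ na]; rewrite gtn_eqF.
  by move=> a /Jn ta; rewrite ffunE ta eqxx.
apply: leq_rank => phi; rewrite memv_cap.
case/andP=> /(extend_flow n)[psi [anti cons van eqn]] _.
exists psi; first by rewrite memv_cap van andbT; apply/flowsP.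
by move=> a /Jn /eqn.
Qed.

(** Both sides are sums of contributions of single levels, obtained by adding
    the levels from the top with [rank_setU]; they agree by [rank_level]. *)
Lemma gamma_minor (R : realFieldType) I :
  (gamma k pi I)%:R =
    minor (fun A => (gamma k (trivial_partition V0) A)%:R : R) h (size pi) I.
Proof.
pose g n : R := (gamma k pi (I :&: upset h n))%:R.
have hr v : (h v < size pi)%N by exact: ltn_ord.
have -> : (gamma k pi I)%:R = g 0%N - g (size pi).
  rewrite /g upset0 setIT (upset_large hr) // setI0.
  by rewrite [gamma k pi set0]rank0 subr0.
rewrite -telescope_ord; apply: eq_bigr => n _; rewrite /slice /g.
rewrite [in LHS]upsetS setIUr.
rewrite [gamma k pi (_ :|: _)]rank_setU [gamma k _ (_ :|: (I :&: _))]rank_setU.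
rewrite !natrD [LHS]addrAC subrr add0r [RHS]addrAC subrr add0r; congr (_%:R).
by apply/esym/rank_level => v; rewrite !inE => /andP[_ /eqP].
Qed.

End ResidueLevels.

(** * Faces of the residue polytope *)

Section ResidueFaces.
Local Open Scope ring_scope.

(** The parts are the fibres of [l], ordered by increasing value. *)
Lemma partition_of_form (V : finType) (R : realFieldType) (l : V -> R) :
  exists (pi : ordered_partition V) (t : nat -> R),
    (forall v, l v = t (level pi v)) /\
    (forall n, (n.+1 < size pi)%N -> t n < t n.+1).
Proof.
pose vals := sort <=%O (undup [seq l v | v <- enum V]).
pose fibre x := [set v | l v == x].
have valsP v : l v \in vals by rewrite mem_sort mem_undup map_f ?mem_enum.
have valsE x : x \in vals -> exists v, x = l v.
  by rewrite mem_sort mem_undup => /mapP[v _ ->]; exists v.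
have uniq_vals : uniq vals by rewrite sort_uniq undup_uniq.
have fibre_inj : {in vals &, injective fibre}.
  move=> x y /valsE[v ->] _ /setP/(_ v); rewrite !inE eqxx => /esym/eqP.
  exact: id.
have partP : uniq (map fibre vals) &&
    partition [set B in map fibre vals] [set: V].
  rewrite map_inj_in_uniq // uniq_vals /=; apply/and3P; split => //.
  - apply/eqP/setP=> v; rewrite inE; apply/bigcupP.
    by exists (fibre (l v)); rewrite !inE ?map_f.
  - apply/trivIsetP=> A B; rewrite !inE => /mapP[x _ ->] /mapP[y _ ->] neq.
    rewrite -setI_eq0; apply: contraNT neq => /set0Pn[v].
    by rewrite !inE => /andP[/eqP<- /eqP<-].
  - rewrite inE; apply/mapP=> -[x /valsE[v ->] /setP/(_ v)].
    by rewrite !inE eqxx.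
pose pi := OrderedPartition partP.
have size_pi : size pi = size vals by rewrite size_map.
exists pi, (nth 0 vals); split=> [v|n].
  have : v \in nth set0 pi (level pi v) by rewrite levelP.
  rewrite (nth_map 0) -?size_pi ?ltn_ord // inE => /eqP; exact: id.
rewrite size_pi => nr; have : sorted <%O vals.
  by rewrite sort_lt_sorted undup_uniq.
by move/(sortedP 0); apply.
Qed.

Lemma base_polytope_ext (V : finType) (R : realFieldType)
    (f g : {set V} -> R) q :
  f =1 g -> base_polytope f q <-> base_polytope g q.
Proof.
by move=> fg; split=> -[le_q q_eq]; split=> [I|];
  [rewrite -fg | rewrite -fg | rewrite fg | rewrite fg].
Qed.

Variables (k : fieldType) (R : realType) (G : mgraph).
Variable V0 : (0 < #|vertex G|)%N.
Implicit Types (pi : ordered_partition (vertex G)) (q : {ffun vertex G -> R}).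

Let h pi (v : vertex G) : nat := level pi v.
Let f (I : {set vertex G}) : R := (gamma k (trivial_partition V0) I)%:R.

Let h_lt pi v : (h pi v < size pi)%N. Proof. exact: ltn_ord. Qed.

Let f0 : f set0 = 0. Proof. by rewrite /f [gamma _ _ _]rank0. Qed.

Let f_submodular A B : f (A :|: B) + f (A :&: B) <= f A + f B.
Proof. by rewrite /f -!natrD ler_nat; apply: rank_submodular. Qed.

Lemma residue_polytope_tight pi q :
  residue_polytope_of k R pi q <->
  residue_polytope k R V0 q /\ tight f (h pi) q.
Proof.
rewrite -[residue_polytope k R V0 q]/(base_polytope f q).
rewrite -(base_polytope_minor f0 f_submodular (h_lt pi)).
apply: (@base_polytope_ext _ _ (fun I => (gamma k pi I)%:R)).
exact: gamma_minor.
Qed.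

Lemma residue_polytope_nonempty pi :
  exists q, residue_polytope_of k R pi q.
Proof.
have [q qP] := greedy_tight (h pi) f0 f_submodular.
by exists q; apply/residue_polytope_tight.
Qed.

Lemma residue_polytope_form pi (t : nat -> R) (l : vertex G -> R) :
    (forall v, l v = t (h pi v)) ->
    (forall n, (n.+1 < size pi)%N -> t n < t n.+1) ->
  exists b, (forall q, residue_polytope k R V0 q -> \sum_v l v * q v <= b) /\
    residue_polytope_of k R pi =
      [set q | residue_polytope k R V0 q /\ \sum_v l v * q v = b]%classic.
Proof.
move=> lt tinc; exists (level_max (h pi) (size pi) t f).
have lE q : \sum_v l v * q v = \sum_v t (h pi v) * q v.
  by apply: eq_bigr => v _; rewrite lt.
split=> [q qP|]; first by rewrite lE (level_form_le (h_lt pi)).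
apply/seteqP; split=> q /=; rewrite residue_polytope_tight => -[qP];
  by rewrite lE (level_form_eq (h_lt pi) tinc f0 qP).
Qed.

Lemma residue_polytope_face pi :
  is_face (residue_polytope k R V0) (residue_polytope_of k R pi).
Proof.
split; first exact: residue_polytope_nonempty.
pose l : {ffun vertex G -> R} := [ffun v => (h pi v)%:R].
have [||b bP] := @residue_polytope_form pi (fun n => n%:R) l.
- by move=> v; rewrite ffunE.
- by move=> n _; rewrite ltr_nat.
by exists l, b.
Qed.

(** The valid inequality defining [F] must be the one of
    [residue_polytope_form] for the partition into fibres of [l]: both bounds
    are attained, so both are the maximum of [l]. *)
Lemma face_residue_polytope (F : set {ffun vertex G -> R}) :
  is_face (residue_polytope k R V0) F ->
  exists pi, F = residue_polytope_of k R pi.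
Proof.
case=> -[q0 Fq0] [l [b [le_b FE]]].
have [pi [t [lt tinc]]] := partition_of_form l.
exists pi; have [c [le_c piE]] := residue_polytope_form lt tinc.
rewrite FE piE; suff -> : b = c by [].
apply/eqP; rewrite eq_le; apply/andP; split.
  by move: Fq0; rewrite FE => -[q0P <-]; apply: le_c.
have [q] := residue_polytope_nonempty pi.
by rewrite piE => -[qP <-]; apply: le_b.
Qed.

(** A nonempty upper set of [pi'] starts at the lowest level of [pi] that it
    meets. *)
Lemma coarsening_upset pi pi' n : coarsening pi' pi ->
  exists m, upset (h pi') n = upset (h pi) m.
Proof.
case=> c [c_mono levE].
have h'E v : h pi' v = c (level pi v) by rewrite /h levE.
have [emp|[v0]] := set_0Vmem (upset (h pi') n).
  by exists (size pi); rewrite emp (upset_large (h_lt pi)).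
rewrite inE => nv0; pose P v := (n <= h pi' v)%N.
case: (@arg_minnP _ v0 P (h pi) nv0) => u nu u_min; exists (h pi u).
apply/setP=> v; rewrite !inE; apply/idP/idP => [|uv]; first exact: u_min.
by apply: leq_trans nu _; rewrite !h'E; apply: c_mono.
Qed.

Lemma residue_polytope_sub pi pi' : coarsening pi' pi ->
  (residue_polytope_of k R pi `<=` residue_polytope_of k R pi')%classic.
Proof.
move=> co q /residue_polytope_tight[qP qt]; apply/residue_polytope_tight.
by split=> // n; have [m ->] := coarsening_upset n co.
Qed.

(** The form that cuts out the polytope of [pi] in the residue polytope also
    cuts it out in the smaller polytope of [pi']. *)
Lemma face_coarsening pi pi' : coarsening pi' pi ->
  is_face (residue_polytope_of k R pi') (residue_polytope_of k R pi).
Proof.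
move=> co; have sub := residue_polytope_sub co.
have res q : residue_polytope_of k R pi' q -> residue_polytope k R V0 q.
  by case/residue_polytope_tight.
have [ne [l [b [le_b piE]]]] := residue_polytope_face pi.
split=> //; exists l, b; split=> [q /res|]; first exact: le_b.
apply/seteqP; split=> q /=.
  by move=> qpi; split; [apply: sub | move: qpi; rewrite piE => -[]].
by case=> /res qP lq; rewrite piE.
Qed.

End ResidueFaces.

Theorem theorem1p2 (k : fieldType) (R : realType) (G : mgraph)
    (V0 : (0 < #|vertex G|)%N) :
  [/\ forall pi : ordered_partition (vertex G),
        is_face (residue_polytope k R V0) (residue_polytope_of k R pi),
      forall F : set {ffun vertex G -> R},
        is_face (residue_polytope k R V0) F ->
        exists pi : ordered_partition (vertex G),
          F = residue_polytope_of k R pi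
    & forall pi pi' : ordered_partition (vertex G),
        coarsening pi' pi ->
        (residue_polytope_of k R pi `<=` residue_polytope_of k R pi')%classic /\
        is_face (residue_polytope_of k R pi') (residue_polytope_of k R pi)].
Proof.
split=> [pi|F|pi pi' co]; first exact: residue_polytope_face.
- exact: face_residue_polytope.
- by split; [apply: residue_polytope_sub | apply: face_coarsening].
Qed.
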